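(* Let $X_0, X, Y$ be Banach spaces of analytic functions on $\mathbb{D}$ satisfying the division property, with dualities $X_0^{\ast}\cong Y$ and $Y^{\ast}\cong X$, and assume that on $X$ the shift $M_z$ and all division operators $R_\lambda$, $\lambda\in\mathbb{D}$, are weak-star continuous. Let $E$ be a norm-closed invariant subspace of $X_0$ such that $\operatorname{ind}(E)=N$ for some $N\in\{1,2,\ldots,+\infty\}$. Then the weak-star closure $\overline{E}^{w^{\ast}}\subset X$ of $E$ in $X$ is an invariant, weak-star closed subspace of $X$ and $\operatorname{ind}(\overline{E}^{w^{\ast}})=N$.
   Context: Let $\mathbb{D}$ be the open unit disc. A Banach space $Z$ of analytic functions satisfies the division property if: (i) $Z$ is a Banach space contained in $\mathrm{Hol}(\mathbb{D})$, the space of analytic functions on $\mathbb{D}$; (ii) the evaluation functionals $k_\lambda: f\mapsto f(\lambda)$ are bounded on $Z$ for all $\lambda\in\mathbb{D}$; (iii) $zf\in Z$ whenever $f\in Z$; (iv) if $f\in Z$ and $f(\lambda)=0$ for some $\lambda\in\mathbb{D}$, then there is $g\in Z$ with $(z-\lambda)g(z)=f(z)$. The weak-star ($w^*$) topology on $X$ is the one induced by $Y$ through $Y^*\cong X$. $X_0$ is regarded as a subspace of $X$ through the canonical embedding $X_0\to X_0^{**}\cong X$, which is the inclusion of functions. The shift is $(M_zf)(z)=zf(z)$, and the division operator $R_\lambda$ is defined on $\{f\in X: f(\lambda)=0\}$ by $R_\lambda f=f/(z-\lambda)$. Weak-star continuity of $M_z$ and $R_\lambda$ means continuity with respect to the $w^*$-topology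 of $X$ on domain and range. An invariant subspace is a linear subspace $E$ with $zE:=M_zE\subset E$. For a norm-closed invariant subspace $E$ of $X_0$, or a $w^*$-closed invariant subspace $E$ of $X$, the index is $\operatorname{ind}(E)=\dim(E/zE)$, with $\operatorname{ind}(E)=+\infty$ meaning that $E/zE$ is infinite-dimensional. *)

(* Defs.v *)
From HB Require Import structures.
From mathcomp Require Import all_boot all_order all_algebra.
From mathcomp Require Import all_classical all_reals all_analysis.
From mathcomp.real_closed Require Import complex.
Set Implicit Arguments.
Unset Strict Implicit.
Unset Printing Implicit Defensive.
Import Order.TTheory GRing.Theory Num.Theory.
Import numFieldNormedType.Exports.
Local Open Scope classical_set_scope.
Local Open Scope complex_scope.
Local Open Scope ring_scope.

(* The complex field is R[i] for R : realType.  Its norm, and the norm of every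
   normedModType over it, takes values in R[i] (in fact nonnegative reals). *)

Definition unit_disc (R : realType) : set R[i] := [set z | `|z| < 1].

(* Functions on the disc are total functions R[i] -> R[i] vanishing off the disc,
   so that equality in Hol is Leibniz equality.  Over the scalar field R[i],
   [derivable f z 1] is complex differentiability at z. *)
Definition Hol (R : realType) : set (R[i] -> R[i]) :=
  [set f | (forall z, unit_disc z -> derivable (f : R[i]^o -> R[i]^o) z 1) /\
           (forall z, ~ unit_disc z -> f z = 0)].

(* A Banach space contained in Hol: an abstract Banach space, identified with a
   linear subspace of Hol through the injective linear map [ev]. *)
Record hol_banach (R : realType) := HolBanach {
  hb_space :> completeNormedModType R[i] ;
  ev : {linear hb_space -> (R[i] -> R[i]^o)} ;
  ev_inj : injective ev ;
  ev_hol : forall f : hb_space, Hol (ev f) }.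
Arguments ev {R h}.
Arguments ev_inj {R h}.
Arguments ev_hol {R h}.

Definition division_property (R : realType) (Z : hol_banach R) : Prop :=
  [/\ forall l : R[i], unit_disc l ->
        exists M : R[i], forall f : Z, `|ev f l| <= M * `|f|,
      forall f : Z, exists g : Z,
        forall z, unit_disc z -> ev g z = z * ev f z
    & forall (l : R[i]) (f : Z), unit_disc l -> ev f l = 0 ->
        exists g : Z, forall z, unit_disc z -> (z - l) * ev g z = ev f z].

(* The witnesses chosen in [hol_shift] and [hol_div] exist by the division property
   and are unique: see [hol_shiftE], [hol_divE] and [ev_eq]. *)
Definition hol_shift (R : realType) (Z : hol_banach R) (f : Z) : Z :=
  xget 0 [set g : Z | forall z, unit_disc z -> ev g z = z * ev f z].

(* Only meaningful on {f | f(l) = 0}. *)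
Definition hol_div (R : realType) (Z : hol_banach R) (l : R[i]) (f : Z) : Z :=
  xget 0 [set g : Z | forall z, unit_disc z -> (z - l) * ev g z = ev f z].

Lemma ev_eq (R : realType) (Z : hol_banach R) (f g : Z) :
  (forall z, unit_disc z -> ev f z = ev g z) -> f = g.
Proof.
move=> fg; apply: (@ev_inj _ Z); apply/funext => z.
have [/fg//|nz] := pselect (unit_disc z).
by rewrite (ev_hol f).2// (ev_hol g).2.
Qed.

Lemma hol_shiftE (R : realType) (Z : hol_banach R) (f : Z) :
  division_property Z ->
  forall z, unit_disc z -> ev (hol_shift f) z = z * ev f z.
Proof.
case=> _ /(_ f)[g gP] _.
exact: (@xgetPex _ 0 [set g | forall z, _ -> ev g z = z * ev f z]
  (ex_intro _ g gP)).
Qed.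

Lemma hol_divE (R : realType) (Z : hol_banach R) (l : R[i]) (f : Z) :
  division_property Z -> unit_disc l -> ev f l = 0 ->
  forall z, unit_disc z -> (z - l) * ev (hol_div l f) z = ev f z.
Proof.
case=> _ _ /(_ l f) /[apply] /[apply] -[g gP].
exact: (@xgetPex _ 0 [set g | forall z, _ -> (z - l) * ev g z = ev f z]
  (ex_intro _ g gP)).
Qed.

Definition dual_space (R : realType) (V : normedModType R[i]) :
    set (V -> R[i]) :=
  [set phi | linear (phi : V -> R[i]^o) /\
             continuous (phi : V -> R[i]^o)].

Definition dual_norm (R : realType) (V : normedModType R[i])
    (phi : V -> R[i]) : R :=
  sup [set complex.Re `|phi x| | x in [set x : V | `|x| <= 1]].

(* J is an isomorphism of normed spaces (not necessarily isometric) from W onto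
   the dual of V. *)
Definition dual_iso (R : realType) (V W : normedModType R[i])
    (J : W -> V -> R[i]) : Prop :=
  [/\ linear (J : W -> (V -> R[i]^o)),
      set_bij setT (@dual_space R V) J
    & exists a b : R, [/\ 0 < a, 0 < b &
        forall w : W, a%:C * `|w| <= (dual_norm (J w))%:C <= b%:C * `|w|]].

(* The canonical embedding X0 -> X0^** ~ Y^* ~ X induced by the isomorphisms
   jY : Y ~ X0^* and jX : X ~ Y^*. *)
Definition bidual_embedding (R : realType) (X0 X Y : normedModType R[i])
    (jY : Y -> X0 -> R[i]) (jX : X -> Y -> R[i]) (f : X0) : X :=
  xget 0 [set F : X | forall y : Y, jX F y = jY y f].

Definition weak_star (R : realType) (X Y : normedModType R[i])
    (jX : X -> Y -> R[i]) : topologicalType :=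
  initial_topology (jX : X -> {ptws Y -> R[i]^o}).

Definition weak_star_closed (R : realType) (X Y : normedModType R[i])
    (jX : X -> Y -> R[i]) (E : set X) : Prop :=
  closed (E : set (weak_star jX)).

Definition weak_star_closure (R : realType) (X Y : normedModType R[i])
    (jX : X -> Y -> R[i]) (E : set X) : set X :=
  closure (E : set (weak_star jX)).

Definition weak_star_continuous_on (R : realType) (X Y : normedModType R[i])
    (jX : X -> Y -> R[i]) (A : set X) (T : X -> X) : Prop :=
  {within (A : set (weak_star jX)),
    continuous (T : weak_star jX -> weak_star jX)}.

Definition invariant_subspace (R : realType) (Z : hol_banach R)
    (E : set Z) : Prop :=
  submod_closed (mem E) /\ (@hol_shift R Z) @` E `<=` E.

(* The cosets of the e i form a basis of the quotient vector space E / F. *)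
Definition quotient_basis (R : realType) (V : lmodType R[i]) (E F : set V)
    (n : nat) (e : 'I_n -> V) : Prop :=
  (forall i, E (e i)) /\
  (forall f, E f -> exists! c : 'rV[R[i]]_n, F (f - \sum_i c 0 i *: e i)).

(* dim (E / F) = N, where None stands for +oo. *)
Definition quotient_dim (R : realType) (V : lmodType R[i]) (E F : set V)
    (N : option nat) : Prop :=
  if N is Some n then exists e : 'I_n -> V, quotient_basis E F e
  else forall (n : nat) (e : 'I_n -> V), ~ quotient_basis E F e.

Definition shift_index (R : realType) (Z : hol_banach R) (E : set Z)
    (N : option nat) : Prop :=
  quotient_dim E ((@hol_shift R Z) @` E) N.

(* Main.v *)
(* By the bipolar theorem the weak-star closure Ebar of E is its double
   annihilator, and by Hahn-Banach X0 meets Ebar exactly in E; hence X0 meets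
   z Ebar exactly in zE, and E / zE embeds into Ebar / z Ebar.

   Conversely z Ebar contains the weak-star closure of zE: since R_0 is weak-star
   continuous on {F | F(0) = 0}, it is enough that every F in that closure
   vanishes at 0.  This holds because evaluation at 0 is represented on all of X
   by an element of Y, unless every function of X0 vanishes at 0.  In that case
   the boundedness of the division operators makes the set of common zeros of X0
   open in the disc; it is also closed, so X0 = 0.

   If E / zE has a finite basis (e_i), an element F of Ebar, seen as a functional
   on the annihilator of zE, vanishes on the common kernel of the e_i, so F is a
   combination of the e_i modulo the weak-star closure of zE. *)

From HB Require Import structures.
Require Import Defs.
From mathcomp Require Import all_boot all_order all_algebra.
From mathcomp Require Import all_classical all_reals all_analysis.
From mathcomp Require Import ring lra.
From mathcomp.real_closed Require Import complex.
Import Order.TTheory GRing.Theory Num.Theory.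
Import numFieldNormedType.Exports.
Local Open Scope classical_set_scope.
Local Open Scope complex_scope.
Local Open Scope ring_scope.

Set Implicit Arguments.
Unset Strict Implicit.

(** * Linear algebra *)

Definition lin_subspace {K : fieldType} {V : lmodType K} (W : set V) : Prop :=
  W 0 /\ forall a u v, W u -> W v -> W (a *: u + v).

(** Linearity is asked only on [W], so that an induction can shrink [W] to the kernel of a
    functional inside the same ambient space, and so that coordinate functions that are meaningful
    only on a subspace qualify. *)
Definition linear_on {K : fieldType} {V : lmodType K} (W : set V)
    (f : V -> K) : Prop :=
  forall a u v, W u -> W v -> f (a *: u + v) = a * f u + f v.

Section LinearAlgebra.
Context {K : fieldType} {V : lmodType K}.
Implicit Types (W F : set V) (f g : V -> K).

Lemma lin_subspace_sum W n (c : 'I_n -> K) (e : 'I_n -> V) :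
  lin_subspace W -> (forall i, W (e i)) -> W (\sum_i c i *: e i).
Proof.
move=> [W0 WZ] We; elim/big_ind: _ => // [x y Wx Wy|i _].
  by rewrite -[x]scale1r; exact: WZ.
by rewrite -[X in W X]addr0; exact: WZ.
Qed.

Lemma lin_subspaceB W u v : lin_subspace W -> W u -> W v -> W (u - v).
Proof. by move=> [_ WZ] Wu Wv; rewrite addrC -scaleN1r; exact: WZ. Qed.

Lemma linear_on0 W f : lin_subspace W -> linear_on W f -> f 0 = 0.
Proof.
move=> [W0 _] /(_ 1 _ _ W0 W0); rewrite scale1r addr0 mul1r => /eqP.
by rewrite eq_sym -subr_eq0 addrK => /eqP.
Qed.

Lemma linear_onB W f u v : linear_on W f -> W u -> W v ->
  f (u - v) = f u - f v.
Proof.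
by move=> fW Wu Wv; rewrite addrC -scaleN1r fW// mulN1r addrC.
Qed.

Lemma linear_on_sum W f n (c : 'I_n -> K) (e : 'I_n -> V) :
  lin_subspace W -> linear_on W f -> (forall i, W (e i)) ->
  f (\sum_i c i *: e i) = \sum_i c i * f (e i).
Proof.
move=> sW fW; elim: n c e => [|n IH] c e We.
  by rewrite !big_ord0 (linear_on0 sW fW).
rewrite !big_ord_recl fW ?IH//.
exact: lin_subspace_sum.
Qed.

Lemma linear_on_sub W W' f : W' `<=` W -> linear_on W f -> linear_on W' f.
Proof. by move=> W'W fW a u v /W'W Wu /W'W Wv; exact: fW. Qed.

Lemma lin_subspace_ker W f : lin_subspace W -> linear_on W f ->
  lin_subspace (W `&` [set u | f u = 0]).
Proof.
move=> sW fW; split; first by split; [case: sW | exact: linear_on0 sW fW].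
move=> a u v [Wu fu] [Wv fv]; split; first exact: sW.2.
by rewrite /= fW// fu fv mulr0 addr0.
Qed.

(** Induction on [n]: if [f ord0] vanishes on [W] it gets coefficient 0; otherwise the induction
    hypothesis is applied on its kernel, which is complemented in [W] by the line through any [w]
    with [f ord0 w <> 0]. *)
Lemma ker_span W n (f : 'I_n -> V -> K) g :
  lin_subspace W -> linear_on W g -> (forall i, linear_on W (f i)) ->
  (forall u, W u -> (forall i, f i u = 0) -> g u = 0) ->
  exists c : 'I_n -> K, forall u, W u -> g u = \sum_i c i * f i u.
Proof.
elim: n f g W => [|n IH] f g W sW gW fW fg.
  by exists (fun=> 0) => u Wu; rewrite big_ord0; apply: fg => // -[].
pose f' i := f (lift ord0 i).
have [[w [Ww fw]]|nw] := pselect (exists w, W w /\ f ord0 w <> 0); last first.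
  have f0 u : W u -> f ord0 u = 0.
    by move=> Wu; apply: contrapT => fu; apply: nw; exists u.
  have [||c cP] := IH f' g W sW gW; first by move=> i; exact: fW.
    move=> u Wu fu; apply: fg => // i.
    by have [j ->|->] := unliftP ord0 i; [exact: fu|exact: f0].
  exists (fun i => if unlift ord0 i is Some j then c j else 0) => u Wu.
  rewrite big_ord_recl unlift_none mul0r add0r cP//.
  by apply: eq_bigr => i _; rewrite liftK.
have {}fw : f ord0 w != 0 by apply/eqP.
pose W' := W `&` [set u | f ord0 u = 0].
have W'W : W' `<=` W by move=> u [].
have [||||c cP] := IH f' g W'.
- exact: lin_subspace_ker.
- exact: linear_on_sub gW.
- by move=> i; exact: linear_on_sub (fW _).
- move=> u [Wu fu0] fu; apply: fg => // i.
  by have [j ->|->] := unliftP ord0 i; [exact: fu|].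
(* The coefficient of [f ord0] is forced by the required identity at [w]. *)
pose d := (g w - \sum_i c i * f' i w) / f ord0 w.
exists (fun i => if unlift ord0 i is Some j then c j else d) => u Wu.
rewrite big_ord_recl unlift_none.
under eq_bigr do rewrite liftK.
(* With this [a], [a *: w + u] is the projection of [u] onto the kernel of [f ord0] along [w]. *)
pose a := - (f ord0 u / f ord0 w).
have W'u : W' (a *: w + u).
  by split; [exact: sW.2|rewrite /= fW// mulNr divfK// addNr].
have f'D : \sum_i c i * f' i (a *: w + u) =
    a * (\sum_i c i * f' i w) + \sum_i c i * f' i u.
  rewrite mulr_sumr -big_split; apply: eq_bigr => i _.
  by rewrite [f' i _]fW// mulrDr mulrCA.
have := cP _ W'u; rewrite gW// f'D => gwu.
rewrite -[LHS](addKr (a * g w)) gwu /d /a -/(f' _).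
by field.
Qed.

(** A common kernel of [n] functionals has finite codimension. The induction is that of [ker_span]:
    a functional vanishing on [W] is dropped, any other one contributes one basis vector [w], so [m]
    may be smaller than [n]. *)
Lemma finite_quotient_basis n (f : 'I_n -> V -> K) W F :
  lin_subspace W -> (forall i, linear_on W (f i)) ->
  (forall u, W u -> F u <-> forall i, f i u = 0) -> F `<=` W ->
  exists m (e : 'I_m -> V), [/\ forall i, W (e i),
    forall u, W u -> exists c : 'I_m -> K, F (u - \sum_i c i *: e i) &
    forall c : 'I_m -> K, F (\sum_i c i *: e i) -> forall i, c i = 0].
Proof.
elim: n f W => [|n IH] f W sW fW fF FW.
  exists 0%N, (fun=> 0); split=> [[]//|u Wu|c _ []//].
  by exists (fun=> 0); rewrite big_ord0 subr0; apply/fF => // -[].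
pose f' i := f (lift ord0 i).
have split_ord u :
    (forall i, f i u = 0) <-> f ord0 u = 0 /\ forall i, f' i u = 0.
  split=> [fu|[f0u f'u] i]; first by split=> [|i]; exact: fu.
  by have [j ->|->] := unliftP ord0 i; [exact: f'u|].
have [[w [Ww fw]]|nw] := pselect (exists w, W w /\ f ord0 w <> 0); last first.
  apply: (IH f') => // [i|u Wu]; first exact: fW.
  rewrite fF// split_ord; split=> [[]//|f'u]; split=> //.
  by apply: contrapT => fu; apply: nw; exists u.
have {}fw : f ord0 w != 0 by apply/eqP.
pose W' := W `&` [set u | f ord0 u = 0].
have W'W : W' `<=` W by move=> u [].
have FW' : F `<=` W'.
  by move=> u Fu; split; [exact: FW|apply: (fF _ (FW _ Fu)).1].
have [||u [Wu f0u]||m [e [We spane freee]]] := IH f' W'.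
- exact: lin_subspace_ker.
- by move=> i; exact: linear_on_sub (fW _).
- by rewrite fF// split_ord; split=> [[]|].
- exact: FW'.
exists m.+1, (fun i => if unlift ord0 i is Some j then e j else w); split.
- by move=> i; case: unliftP => [j|] _ //; exact: W'W.
- move=> u Wu; pose a := f ord0 u / f ord0 w.
  have [|c Fc] := spane (- a *: w + u).
    by split; [exact: sW.2|rewrite /= fW// mulNr divfK// addNr].
  exists (fun i => if unlift ord0 i is Some j then c j else a).
  rewrite big_ord_recl unlift_none; under eq_bigr do rewrite liftK.
  by rewrite opprD addrA -scaleNr (addrC u).
- move=> c; rewrite big_ord_recl unlift_none; under eq_bigr do rewrite liftK.
  pose s := \sum_i c (lift ord0 i) *: e i.
  have W's : W' s by apply: lin_subspace_sum => //; exact: lin_subspace_ker.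
  move=> Fs; have [_ /=] := FW' _ Fs.
  rewrite fW ?W's.2 ?addr0//; last exact: W'W.
  move=> /eqP; rewrite mulf_eq0 (negPf fw) orbF => /eqP c0 i.
  move: Fs; rewrite c0 scale0r add0r => /freee Fs.
  by have [j ->|->] := unliftP ord0 i; [exact: Fs|].
Qed.

End LinearAlgebra.

Lemma quotient_basisP (R : realType) (V : lmodType R[i]) (E F : set V) n
    (e : 'I_n -> V) : lin_subspace E -> lin_subspace F ->
  quotient_basis E F e <-> [/\ forall i, E (e i),
    forall u, E u -> exists c : 'I_n -> R[i], F (u - \sum_i c i *: e i) &
    forall c : 'I_n -> R[i], F (\sum_i c i *: e i) -> forall i, c i = 0].
Proof.
move=> sE sF; split=> [[Ee eP]|[Ee spane freee]].
  split=> // [u /eP[c [Fc _]]|c Fc i].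
    by exists (c 0).
  (* Both the zero row and the row [- c] represent the vector 0 modulo [F]; uniqueness makes them
     equal. *)
  have [c0 [_ c0P]] := eP _ sE.1.
  have -> : c i = (\row_j - (- c j)) 0 i by rewrite mxE opprK.
  rewrite -(c0P (\row_j - - c j)) ?(c0P 0) ?mxE//.
    by rewrite big1 ?subr0; [case: sF|move=> j _; rewrite mxE scale0r].
  rewrite add0r -scaleN1r -[X in F X]addr0; apply: sF.2; last by case: sF.
  by under eq_bigr do rewrite mxE opprK.
split=> // u Eu; have [c Fc] := spane _ Eu.
exists (\row_j c j); split=> [|d Fd].
  by under eq_bigr do rewrite mxE.
apply/rowP => j; rewrite mxE; apply/eqP; rewrite -subr_eq0; apply/eqP.
apply: (freee (fun j => c j - d 0 j)).
have := lin_subspaceB sF Fd Fc; rewrite opprB addrC addrA subrK -sumrB.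
by under eq_bigr do rewrite -scalerBl.
Qed.

Lemma submod_closedE (K : fieldType) (V : lmodType K) (W : set V) :
  submod_closed (mem W) <-> lin_subspace W.
Proof.
split=> -[W0 WZ]; split.
- by move: W0; rewrite in_setE.
- by move=> a u v /mem_set Wu /mem_set Wv; apply/set_mem/WZ.
- exact/mem_set.
- by move=> a u v /set_mem Wu /set_mem Wv; exact/mem_set/WZ.
Qed.

(** * The Hahn-Banach theorem *)

(* The norm as an element of [R]; [`|x|] itself lives in [R[i]]. *)
Definition rnorm {R : realType} {V : normedZmodType R[i]} (x : V) : R :=
  complex.Re `|x|.

Section RealNorm.
Context {R : realType} {V : normedZmodType R[i]}.
Implicit Types x y : V.

Lemma rnormE x : `|x| = (rnorm x)%:C.
Proof. by rewrite /rnorm RRe_real// normr_real. Qed.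

Lemma rnorm_ge0 x : 0 <= rnorm x.
Proof. by rewrite -ler0c -rnormE. Qed.

Lemma rnormD x y :
  rnorm (x + y) <= rnorm x + rnorm y.
Proof. by rewrite -lecR rmorphD/= -!rnormE ler_normD. Qed.

Lemma rnormN x : rnorm (- x) = rnorm x.
Proof. by rewrite /rnorm normrN. Qed.

Lemma rnorm0 : rnorm (0 : V) = 0.
Proof. by rewrite /rnorm normr0. Qed.

Lemma rnorm_eq0 x : rnorm x = 0 -> x = 0.
Proof. by move=> x0; apply/eqP; rewrite -normr_eq0 rnormE x0. Qed.

Lemma rnorm_gt0 x : x != 0 -> 0 < rnorm x.
Proof.
move=> x0; rewrite lt_def rnorm_ge0 andbT; apply: contra_neq x0.
exact: rnorm_eq0.
Qed.

End RealNorm.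

Section RealNormComplex.
Context {R : realType}.
Implicit Types a b : R[i].

Lemma rnormM a b : rnorm (a * b) = rnorm a * rnorm b.
Proof.
by apply: (@complexI R); rewrite rmorphM/= -!rnormE normrM.
Qed.

Lemma rnormX a n : rnorm (a ^+ n) = rnorm a ^+ n.
Proof.
by apply: (@complexI R); rewrite rmorphXn/= -!rnormE normrX.
Qed.

Lemma rnormZ (V : normedModType R[i]) a (x : V) :
  rnorm (a *: x) = rnorm a * rnorm x.
Proof.
by apply: (@complexI R); rewrite rmorphM/= -!rnormE normrZ.
Qed.

Lemma rnorm_real (t : R) : rnorm t%:C = `|t|.
Proof. by rewrite /rnorm normc_def/= expr0n addr0 sqrtr_sqr. Qed.

Lemma rnormi : rnorm ('i : R[i]) = 1.
Proof. by rewrite /rnorm normc_def/= expr0n add0r expr1n sqrtr1. Qed.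

End RealNormComplex.

(** * Real-linear functionals below a sublinear functional *)

Section HahnBanach.
Context {R : realType} {V : lmodType R[i]}.
Implicit Types p : V -> R.

(** Homogeneity is stated as an inequality because this passes easily to infima; equality follows in
    [sublinearZ]. *)
Definition sublinear p :=
  (forall x y, p (x + y) <= p x + p y) /\
  forall (t : R) x, 0 <= t -> p (t%:C *: x) <= t * p x.

Lemma sublinear0 p : sublinear p -> p 0 = 0.
Proof.
move=> [pD pZ]; have := pZ 0 0 (lexx _); rewrite scaler0 mul0r.
have := pD 0 0; rewrite addr0 -lerBlDr subrr => p0 p0'.
by apply/eqP; rewrite eq_le p0 p0'.
Qed.

Lemma sublinearZ p (t : R) x : sublinear p -> 0 <= t ->
  p (t%:C *: x) = t * p x.
Proof.
move=> sp; rewrite le_eqVlt => /predU1P[<-|t0].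
  by rewrite scale0r mul0r sublinear0.
apply/eqP; rewrite eq_le (sp.2 _ _ (ltW t0))/= -ler_pdivlMl//.
have := sp.2 t^-1 (t%:C *: x); rewrite invr_ge0 ltW// => /(_ isT).
by rewrite scalerA -rmorphM/= mulVf ?gt_eqF// scale1r.
Qed.

Lemma sublinearN p x : sublinear p -> - p (- x) <= p x.
Proof.
move=> sp; have := sp.1 x (- x).
by rewrite subrr sublinear0// -lerBlDr sub0r.
Qed.

(* [sub_along p a] is sublinear and lies below [p], so a minimal sublinear [p]
   equals it for every [a]; taking [t = 1] then forces [p] to be additive. *)
Definition sub_along p a x :=
  inf [set p (x + t%:C *: a) - t * p a | t in [set t | 0 <= t]].

Lemma sub_along_le p a x t : sublinear p -> 0 <= t ->
  sub_along p a x <= p (x + t%:C *: a) - t * p a.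
Proof.
move=> sp t0; apply: ge_inf; last by exists t.
exists (- p (- x)) => _ [s s0 <-].
rewrite -sublinearZ// lerBrDl; have := sp.1 (x + s%:C *: a) (- x).
by rewrite addrAC subrr add0r -lerBlDr.
Qed.

Lemma le_sub_along p a x r :
  (forall t, 0 <= t -> r <= p (x + t%:C *: a) - t * p a) ->
  r <= sub_along p a x.
Proof.
move=> rP; apply: lb_le_inf; last by move=> _ [t t0 <-]; exact: rP.
by exists (p (x + 0%:C *: a) - 0 * p a); exists 0 => /=.
Qed.

Lemma sub_along_sub p a x : sublinear p -> sub_along p a x <= p x.
Proof.
move=> sp; apply: le_trans (sub_along_le a x sp (lexx 0)) _.
by rewrite scale0r addr0 mul0r subr0.
Qed.

Lemma sublinear_sub_along p a : sublinear p -> sublinear (sub_along p a).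
Proof.
move=> sp; split=> [x y|t x].
  rewrite -lerBlDr; apply: le_sub_along => t t0.
  rewrite lerBlDr -lerBlDl; apply: le_sub_along => s s0.
  rewrite lerBlDl.
  apply: le_trans (sub_along_le a (x + y) sp (addr_ge0 t0 s0)) _.
  rewrite rmorphD/= scalerDl addrACA mulrDl opprD [leRHS]addrACA lerD2r.
  exact: sp.1.
rewrite le_eqVlt => /predU1P[<-|t0].
  by rewrite scale0r mul0r -(sublinear0 sp) sub_along_sub.
rewrite -ler_pdivrMl//; apply: le_sub_along => s s0.
rewrite ler_pdivrMl//.
apply: le_trans (sub_along_le a _ sp (mulr_ge0 (ltW t0) s0)) _.
by rewrite rmorphM/= -scalerA -scalerDr (sublinearZ _ sp (ltW t0)) mulrBr mulrA.
Qed.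

(** Zorn's lemma yields a minimal sublinear functional below [p]; comparing it with its [sub_along]
    modifications shows that it is additive. The result is linear over the reals only. *)
Lemma hahn_banach_sublinear p : sublinear p ->
  exists u : V -> R, [/\ forall x, u x <= p x,
    forall x y, u (x + y) = u x + u y &
    forall (t : R) x, u (t%:C *: x) = t * u x].
Proof.
move=> sp.
pose T := {q : V -> R | sublinear q /\ forall x, q x <= p x}.
(* The order is reversed, so that maximal elements are minimal functionals. *)
pose le (q r : T) := `[< forall x, sval r x <= sval q x >].
have [|||A chainA|[q [sq qp]] qmin] := @Zorn T le.
- by move=> q; apply/asboolP.
- move=> q r s /asboolP qr /asboolP rs; apply/asboolP => x.
  exact: le_trans (rs x) (qr x).
- move=> q r /asboolP qr /asboolP rq; apply: eq_sig_hprop => [s|].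
    exact: Prop_irrelevance.
  by apply/funext => x; apply/eqP; rewrite eq_le qr rq.
- have [[q0 Aq0]|A0] := pselect (exists q, A q); last first.
    have pP : sublinear p /\ forall x, p x <= p x by [].
    by exists (exist _ p pP) => q Aq; exfalso; apply: A0; exists q.
  (* A nonempty chain is bounded by its pointwise infimum, which is finite because [- p (- x)] is a
     lower bound. *)
  pose m x := inf [set sval q x | q in A].
  have m_le q x : A q -> m x <= sval q x.
    move=> Aq; apply: ge_inf; last by exists q.
    exists (- p (- x)) => _ [[r [sr rp]] _ <-] /=.
    by apply: le_trans (sublinearN x sr); rewrite lerN2.
  have le_m x r : (forall q, A q -> r <= sval q x) -> r <= m x.
    move=> rP; apply: lb_le_inf; last by move=> _ [q Aq <-]; exact: rP.
    by exists (sval q0 x); exists q0.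
  have mP : sublinear m /\ forall x, m x <= p x.
    split; last by move=> x; apply: le_trans (m_le _ x Aq0) ((svalP q0).2 x).
    split=> [x y|t x].
      rewrite -lerBlDr; apply: (le_m) => q Aq.
      rewrite lerBlDr -lerBlDl; apply: (le_m) => r Ar; rewrite lerBlDl.
      (* The smaller of [q] and [r] serves for both summands; this is where the chain condition
         enters. *)
      have [/asboolP qr|/asboolP rq] := chainA q r Aq Ar.
        apply: le_trans (m_le r _ Ar) _; apply: le_trans ((svalP r).1.1 x y) _.
        by rewrite lerD2r.
      apply: le_trans (m_le q _ Aq) _; apply: le_trans ((svalP q).1.1 x y) _.
      by rewrite lerD2l.
    rewrite le_eqVlt => /predU1P[<-|t0].
      rewrite scale0r mul0r -(sublinear0 (svalP q0).1); exact: m_le.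
    rewrite -ler_pdivrMl//; apply: (le_m) => q Aq; rewrite ler_pdivrMl//.
    by rewrite -(sublinearZ _ (svalP q).1 (ltW t0)); exact: m_le.
  by exists (exist _ m mP) => q Aq; apply/asboolP => x; exact: m_le.
have qD x a : q (x + a) = q x + q a.
  have aP : sublinear (sub_along q a) /\ forall x, sub_along q a x <= p x.
    split; first exact: sublinear_sub_along.
    by move=> z; apply: le_trans (sub_along_sub a z sq) (qp z).
  have /(congr1 sval)/= qa :
      exist _ (sub_along q a) aP = exist _ q (conj sq qp) :> T.
    by apply: qmin; apply/asboolP => z; exact: sub_along_sub.
  apply/eqP; rewrite eq_le sq.1/= -lerBrDr -[in leLHS]qa.
  have := sub_along_le a x sq ler01.
  by rewrite scale1r mul1r.
exists q; split=> [||t x]; [exact: qp|exact: qD|].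
have qN y : q (- y) = - q y.
  by apply/eqP; rewrite -addr_eq0 -qD addNr sublinear0.
have [t0|/ltW t0] := leP 0 t; first exact: sublinearZ.
rewrite -[t]opprK rmorphN/= scaleNr qN sublinearZ ?oppr_ge0//.
by rewrite !mulNr.
Qed.

End HahnBanach.

(** * Separation of a point from a closed subspace of a complex normed space *)

Section HahnBanachNormed.
Context {R : realType} {V : normedModType R[i]}.
Implicit Types (E : set V) (x : V).

Lemma dual_spaceP (phi : V -> R[i]) : dual_space phi <->
  linear (phi : V -> R[i]^o) /\
  exists M : R, forall x, rnorm (phi x) <= M * rnorm x.
Proof.
split=> [[lphi cphi]|[lphi [M phiM]]]; split => //.
  pose f : {linear V -> R[i]^o} := HB.pack (phi : V -> R[i]^o)
    (GRing.isLinear.Build _ _ _ _ _ lphi).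
  have /linear_boundedP/pinfty_ex_gt0[M M0 phiM] :
    bounded_near f (nbhs 0) by exact/linear_bounded_continuous.
  exists (complex.Re M) => x; rewrite -lecR rmorphM/= -!rnormE.
  by rewrite RRe_real ?gtr0_real//; exact: phiM.
pose f : {linear V -> R[i]^o} := HB.pack (phi : V -> R[i]^o)
  (GRing.isLinear.Build _ _ _ _ _ lphi).
apply: (@bounded_linear_continuous _ _ _ f).
apply/ex_bound; exists `|M|%:C; apply/nbhs_norm0P; exists 1 => //= x /=.
rewrite !rnormE lecR -[1]/(1%:C) ltcR => x1.
apply: le_trans (phiM x) _.
apply: le_trans (ler_wpM2r (rnorm_ge0 x) (ler_norm M)) _.
by rewrite ler_piMr ?normr_ge0// ltW.
Qed.

Definition set_dist E x : R := inf [set rnorm (x - e) | e in E].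

Lemma set_dist_le E x e : E e -> set_dist E x <= rnorm (x - e).
Proof.
move=> Ee; apply: ge_inf; last by exists e.
by exists 0 => _ [y _ <-]; exact: rnorm_ge0.
Qed.

Lemma le_set_dist E x (r : R) : E !=set0 ->
  (forall e, E e -> r <= rnorm (x - e)) -> r <= set_dist E x.
Proof.
move=> [e0 Ee0] rP; apply: lb_le_inf; last by move=> _ [e Ee <-]; exact: rP.
by exists (rnorm (x - e0)); exists e0.
Qed.

Lemma set_dist_ge0 E x : E !=set0 -> 0 <= set_dist E x.
Proof. by move=> E0; apply: le_set_dist => // e _; exact: rnorm_ge0. Qed.

Lemma set_dist_gt0 E x : E !=set0 -> closed E -> ~ E x -> 0 < set_dist E x.
Proof.
move=> E0 cE nEx; rewrite lt_neqAle set_dist_ge0// andbT eq_sym.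
apply/eqP => d0; apply: nEx; apply: cE => B /nbhs_normP[e /= e0 eB].
have eR : 0 < complex.Re e by move: e0; rewrite ltcE => /andP[].
have : set_dist E x < complex.Re e by rewrite d0.
move=> /inf_lt[|_ [y Ey <-] xy].
  by case: E0 => y Ey; exists (rnorm (x - y)), y.
exists y; split=> //; apply: eB => /=.
by rewrite rnormE -(RRe_real (gtr0_real e0)) ltcR.
Qed.

Lemma sublinear_set_dist E : lin_subspace E -> sublinear (set_dist E).
Proof.
move=> sE; have E0 : E !=set0 by exists 0; case: sE.
split=> [x y|t x].
  rewrite -lerBlDr; apply: le_set_dist => // e Ee.
  rewrite lerBlDr -lerBlDl; apply: le_set_dist => // e' Ee'; rewrite lerBlDl.
  have Ee2 : E (e + e') by rewrite -[e]scale1r; exact: sE.2.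
  apply: le_trans (set_dist_le _ Ee2) _.
  by rewrite opprD addrACA rnormD.
rewrite le_eqVlt => /predU1P[<-|t0].
  rewrite scale0r mul0r; apply: le_trans (set_dist_le _ sE.1) _.
  by rewrite subrr rnorm0.
rewrite -ler_pdivrMl//; apply: le_set_dist => // e Ee; rewrite ler_pdivrMl//.
have Ee' : E (t%:C *: e).
  by rewrite -[X in E X]addr0; apply: sE.2 => //; case: sE.
apply: le_trans (set_dist_le _ Ee') _.
by rewrite -scalerBr rnormZ rnorm_real gtr0_norm.
Qed.

(** The dominating functional is not the distance [d] to [E] but [sub_along d x], whose value at
    [- x] is at most [- d x < 0]. A real functional [u] below it therefore satisfies [u x > 0],
    while [u <= d] makes it vanish on [E]. *)
Lemma hahn_banach_separation E x : lin_subspace E -> closed E -> ~ E x ->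
  exists phi : V -> R[i],
    [/\ dual_space phi, forall e, E e -> phi e = 0 & phi x <> 0].
Proof.
move=> sE cE nEx; have E0 : E !=set0 by exists 0; case: sE.
have sd := sublinear_set_dist sE.
have [u [ud uD uZ]] := hahn_banach_sublinear (sublinear_sub_along x sd).
have uN y : u (- y) = - u y.
  by have := uZ (-1) y; rewrite rmorphN rmorph1 scaleN1r mulN1r.
have u_le y : u y <= set_dist E y.
  exact: le_trans (ud y) (sub_along_sub x y sd).
have u_bound y : `|u y| <= rnorm y.
  have d_le z : set_dist E z <= rnorm z.
    by apply: le_trans (set_dist_le _ sE.1) _; rewrite subr0.
  rewrite ler_norml (le_trans (u_le y) (d_le y)) andbT lerNl -uN.
  by rewrite -[leRHS]rnormN (le_trans (u_le _)).
have uE e : E e -> u e = 0.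
  have uE_le z : E z -> u z <= 0.
    move=> Ez; apply: le_trans (u_le z) _.
    by apply: le_trans (set_dist_le _ Ez) _; rewrite subrr rnorm0.
  move=> Ee; apply/eqP; rewrite eq_le uE_le//= -oppr_le0 -uN uE_le//.
  by rewrite -[- e]add0r; apply: lin_subspaceB => //; case: sE.
(* The usual complexification [u y - i u (i y)] of a real-linear functional. *)
pose phi y : R[i] := u y +i* (- u ('i *: y)).
have uC (a : R[i]) y :
    u (a *: y) = complex.Re a * u y + complex.Im a * u ('i *: y).
  by rewrite {1}[a]complexE scalerDl uD mulrC -scalerA !uZ.
exists phi; split.
- apply/dual_spaceP; split.
    move=> a y z; rewrite /phi uD uC scalerDr uD.
    have -> : 'i *: (a *: y) = a *: ('i *: y) by rewrite !scalerA mulrC.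
    have -> : u (a *: ('i *: y)) =
        complex.Re a * u ('i *: y) - complex.Im a * u y.
      by rewrite uC scalerA -expr2 sqr_i scaleN1r uN mulrN.
    case: a => a b /=; apply/eqP; rewrite eq_complex /=.
    by apply/andP; split; apply/eqP; ring.
  (* The real and imaginary parts are each bounded by the norm of [y]. *)
  exists 2 => y; rewrite [phi y]complexE/=.
  apply: le_trans (rnormD _ _) _.
  rewrite rnormM rnormi !rnorm_real mul1r normrN mulr_natl mulr2n lerD//.
  by apply: le_trans (u_bound _) _; rewrite rnormZ rnormi mul1r.
- move=> e Ee; rewrite /phi !uE ?oppr0//.
  by rewrite -[X in E X]addr0; apply: sE.2 => //; case: sE.
- move=> /(congr1 (@complex.Re R))/= ux0.
  have := ud (- x); rewrite uN ux0 oppr0 leNgt => /negP; apply.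
  apply: le_lt_trans (sub_along_le x _ sd ler01) _.
  by rewrite scale1r addNr mul1r (sublinear0 sd) sub0r oppr_lt0 set_dist_gt0.
Qed.

End HahnBanachNormed.

(** * Uniform boundedness *)

Section UniformBoundedness.
Context {R : realType} {V : completeNormedModType R[i]}.

Lemma cvg_halving_steps (x : nat -> V) (r : nat -> R) :
  (forall n, 0 < r n) -> (forall n, r n.+1 <= r n / 2) ->
  (forall n, rnorm (x n.+1 - x n) <= r n) ->
  exists l, forall n, rnorm (l - x n) <= 2 * r n.
Proof.
move=> r0 r_half x_step.
have x_dist n k : rnorm (x (n + k)%N - x n) <= 2 * r n.
  (* The subtracted term makes the induction on [k] close: halving of the radii absorbs each new
     step. *)
  suff : rnorm (x (n + k)%N - x n) <= 2 * r n - 2 * r (n + k)%N.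
    by have := r0 (n + k)%N; lra.
  elim: k => [|k IH]; first by rewrite addn0 !subrr rnorm0.
  have := rnormD (x (n + k.+1)%N - x (n + k)%N) (x (n + k)%N - x n).
  rewrite addrA subrK addnS => h.
  have := x_step (n + k)%N; have := r_half (n + k)%N; lra.
have r_pow n : r n * 2 ^+ n <= r 0%N.
  elim: n => [|n]; first by rewrite mulr1.
  apply: le_trans; rewrite exprS mulrA ler_wpM2r ?exprn_ge0//.
  by rewrite -ler_pdivlMr.
have r_small (e : R) : 0 < e -> exists n, 2 * r n < e.
  move=> e0; pose n := Num.truncn (2 * r 0%N / e); exists n.
  have n_gt : 2 * r 0%N / e < n.+1%:R by rewrite truncnS_gt.
  have n_pow : n.+1%:R <= 2 ^+ n :> R by rewrite -natrX ler_nat ltn_expl.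
  have := lt_le_trans n_gt n_pow; rewrite ltr_pdivrMr// => h.
  rewrite -(@ltr_pM2r _ (2 ^+ n)) ?exprn_gt0//.
  by have := r_pow n; lra.
have cx : cvg (x @ \oo).
  apply/cauchy_cvgP/cauchy_exP => e e0.
  have eR : 0 < complex.Re e by move: e0; rewrite ltcE => /andP[].
  have [n rn] := r_small _ eR; exists (x n); exists n => // m /= nm.
  rewrite -ball_normE /ball_/= -(RRe_real (gtr0_real e0)) rnormE ltcR.
  apply: le_lt_trans rn; rewrite -rnormN opprB -(subnKC nm); exact: x_dist.
exists (lim (x @ \oo)) => n; apply/ler_addgt0Pr => e e0.
have e0' : 0 < e%:C by rewrite ltcR.
have /cvgrPdist_lt/(_ _ e0')[N _ NP] := cx.
have := NP (n + N)%N; rewrite /= leq_addl => /(_ isT).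
rewrite rnormE ltcR => lx.
have := rnormD (lim (x @ \oo) - x (n + N)%N) (x (n + N)%N - x n).
rewrite addrA subrK => h; have := x_dist n N; lra.
Qed.

(* Gliding hump: each step moves the point so that some [phi i] exceeds [n], and
   then shrinks the radius according to the norm of that [phi i], so that later
   steps change its value by at most 1. *)
Lemma uniform_boundedness (I : Type) (phi : I -> V -> R[i]) :
  (forall i, dual_space (phi i)) ->
  (forall x, exists M : R, forall i, rnorm (phi i x) <= M) ->
  exists M : R, forall i x, rnorm (phi i x) <= M * rnorm x.
Proof.
move=> phi_dual phi_pt; apply: contrapT => unbounded.
have phiB i x y : phi i (x - y) = phi i x - phi i y.
  have [lphi _] := phi_dual i.
  by rewrite addrC -scaleN1r lphi scaleN1r addrC.
have phi0 i : phi i 0 = 0 by rewrite -[in LHS](subrr 0) phiB subrr.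
have phiZ i a x : phi i (a *: x) = a * phi i x.
  have [lphi _] := phi_dual i.
  by rewrite -[a *: x]addr0 lphi phi0 addr0.
have step (s : nat * (V * {posnum R})) : exists t : V * {posnum R} * I,
    [/\ rnorm (t.1.1 - s.2.1) <= s.2.2%:num, t.1.2%:num <= s.2.2%:num / 2,
        s.1%:R < rnorm (phi t.2 t.1.1) &
        forall z, rnorm (z - t.1.1) <= 2 * t.1.2%:num ->
          rnorm (phi t.2 (z - t.1.1)) <= 1].
  case: s => n [x r] /=.
  (* Unboundedness is tested at the constant [2 n / r], so that rescaling [u] to norm [r] gives a
     vector [v] on which [phi i] exceeds [2 n]. *)
  have [i [u iu]] : exists i u, (2 * n%:R / r%:num) * rnorm u < rnorm (phi i u).
    apply: contrapT => nu; apply: unbounded; exists (2 * n%:R / r%:num) => i u.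
    by rewrite leNgt; apply/negP => iu; apply: nu; exists i, u.
  have u0 : 0 < rnorm u.
    apply: rnorm_gt0; apply/eqP => u0.
    by move: iu; rewrite u0 rnorm0 mulr0 phi0 rnorm0 ltxx.
  pose v := (r%:num / rnorm u)%:C *: u.
  have rv : rnorm v = r%:num.
    rewrite rnormZ rnorm_real ger0_norm ?divr_ge0 ?rnorm_ge0// divfK//.
    by rewrite gt_eqF.
  have phiv : 2 * n%:R < rnorm (phi i v).
    rewrite phiZ rnormM rnorm_real ger0_norm ?divr_ge0 ?rnorm_ge0//.
    by rewrite mulrAC ltr_pdivlMr// -ltr_pdivrMl// mulrA [_^-1 * _]mulrC.
  have [y [xy phiy]] : exists y,
      rnorm (y - x) <= r%:num /\ n%:R < rnorm (phi i y).
    (* Either [x] itself works, or [x + v] does by the triangle inequality. *)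
    have [phix|phix] := ltP n%:R (rnorm (phi i x)).
      by exists x; rewrite subrr rnorm0.
    exists (x + v); rewrite addrC addKr rv; split => //.
    have : rnorm (phi i v) <= rnorm (phi i (x + v)) + rnorm (phi i x).
      rewrite -[v in leLHS](addKr x) addrC phiB -[rnorm (phi i x)]rnormN.
      exact: rnormD.
    by move: phix phiv; lra.
  have [_ [B phiB']] := (dual_spaceP (phi i)).1 (phi_dual i).
  (* The factor 2 matches the distance bound [2 * r n] of [cvg_halving_steps]; [|B| + 1] avoids a
     division by zero. *)
  have [r' [r'1 r'2]] : exists r' : {posnum R},
      r'%:num <= r%:num / 2 /\ `|B| * (2 * r'%:num) <= 1.
    have B1 : 0 < (2 * (`|B| + 1))^-1 by rewrite invr_gt0 mulr_gt0// ltr_wpDl.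
    have r'0 : 0 < Num.min (r%:num / 2) (2 * (`|B| + 1))^-1.
      by rewrite lt_min divr_gt0//= B1.
    exists (PosNum r'0); split; first by rewrite /= ge_min lexx.
    have r'B : (PosNum r'0)%:num <= (2 * (`|B| + 1))^-1.
      by rewrite /= ge_min lexx orbT.
    rewrite mulrCA mulrA; apply: le_trans (ler_wpM2l _ r'B) _.
      by rewrite mulr_ge0.
    by rewrite ler_pdivrMr ?mul1r ?ler_pM2l ?mulr_gt0 ?ltr_wpDl// lerDl.
  exists (y, r', i); split=> //= z zy.
  apply: le_trans (phiB' _) _; apply: le_trans r'2.
  apply: le_trans (ler_wpM2r (rnorm_ge0 _) (ler_norm B)) _.
  by rewrite ler_wpM2l.
have [F FP] := choice step.
pose s := fix s n : V * {posnum R} :=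
  if n is m.+1 then (F (m, s m)).1 else (0, PosNum ltr01).
have [|n|n|l lP] :=
  @cvg_halving_steps (fun n => (s n).1) (fun n => (s n).2%:num).
- by [].
- by have [] := FP (n, s n).
- by have [] := FP (n, s n).
have [M phiM] := phi_pt l.
(* Stage [n.+1] makes [phi i y] exceed [n + 1 > M + 1], whereas passing to the limit [l] costs at
   most 1. *)
pose n := (Num.truncn (M + 1)).
pose i := (F (n.+1, s n.+1)).2; pose y := (s n.+2).1.
have phin : n.+1%:R < rnorm (phi i y) by have [] := FP (n.+1, s n.+1).
have phil : rnorm (phi i (l - y)) <= 1.
  by have [_ _ _] := FP (n.+1, s n.+1); apply; exact: lP n.+2.
have := rnormD (phi i l) (- phi i (l - y)); rewrite rnormN phiB opprB subrKC.
have : M + 1 < n.+1%:R by rewrite truncnS_gt.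
move: (phiM i) phil; rewrite phiB; move: phin; lra.
Qed.

End UniformBoundedness.

(** * Weak-star topology *)

Section DualNorm.
Context {R : realType} {V : normedModType R[i]}.
Implicit Types (phi : V -> R[i]) (x : V).

Lemma dual_norm_le phi (C : R) : 0 <= C ->
  (forall x, rnorm (phi x) <= C * rnorm x) -> dual_norm phi <= C.
Proof.
move=> C0 phiC; apply: ge_sup.
  by exists (complex.Re `|phi 0|), 0 => //=; rewrite normr0.
move=> _ [x /= x1 <-]; apply: le_trans (phiC x) _; rewrite ler_piMr//.
by rewrite -lecR -rnormE.
Qed.

Lemma rnorm_dual_norm phi x : dual_space phi ->
  rnorm (phi x) <= dual_norm phi * rnorm x.
Proof.
move=> phi_dual; have [lphi [M phiM]] := (dual_spaceP phi).1 phi_dual.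
have phi0 : phi 0 = 0.
  by have := lphi (-1) 0 0; rewrite !scaleN1r !addNr.
have [->|x0] := eqVneq x 0; first by rewrite phi0 !rnorm0 mulr0.
have rx0 := rnorm_gt0 x0.
rewrite -ler_pdivrMr//; apply: ub_le_sup.
  exists `|M| => _ [y /= y1 <-]; apply: le_trans (phiM y) _.
  apply: le_trans (ler_wpM2r (rnorm_ge0 y) (ler_norm M)) _.
  by rewrite ler_piMr// -lecR -rnormE.
pose a : R[i] := ((rnorm x)^-1)%:C.
have ra : rnorm a = (rnorm x)^-1 by rewrite rnorm_real ger0_norm// invr_ge0 ltW.
exists (a *: x) => /=; first by rewrite rnormE rnormZ ra mulVf ?gt_eqF.
have -> : phi (a *: x) = a * phi x by rewrite -[a *: x]addr0 lphi phi0 addr0.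
by rewrite -[LHS]/(rnorm (a * phi x)) rnormM ra mulrC.
Qed.

End DualNorm.

(** * Duality pairings, annihilators and the bipolar theorem *)

Section DualIso.
Context {R : realType} {V W : normedModType R[i]} {J : W -> V -> R[i]}.
Hypothesis J_iso : dual_iso J.

Lemma dual_iso_dual w : dual_space (J w).
Proof. by have [_ [Jfun _ _] _] := J_iso; exact: Jfun. Qed.

Lemma dual_iso_surj phi : dual_space phi -> exists w, J w = phi.
Proof.
by have [_ [_ _ Jsurj] _] := J_iso => /Jsurj[w _ <-]; exists w.
Qed.

Lemma dual_iso_inj w w' : (forall v, J w v = J w' v) -> w = w'.
Proof.
have [_ [_ Jinj _] _] := J_iso => Jww'.
by apply: Jinj; rewrite ?in_setE//; apply/funext.
Qed.

Lemma dual_isoP a v v' w : J w (a *: v + v') = a * J w v + J w v'.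
Proof. by have [lJ _] := dual_iso_dual w; exact: lJ. Qed.

Lemma dual_isoPl a w w' v : J (a *: w + w') v = a * J w v + J w' v.
Proof. by have [lJ _ _] := J_iso; rewrite lJ. Qed.

Lemma dual_iso0 w : J w 0 = 0.
Proof.
by have := dual_isoP (-1) 0 0 w; rewrite scaleN1r addNr mulN1r addNr.
Qed.

Lemma dual_iso0l v : J 0 v = 0.
Proof.
by have := dual_isoPl (-1) 0 0 v; rewrite scaleN1r addNr mulN1r addNr.
Qed.

Lemma dual_isoZl a w v : J (a *: w) v = a * J w v.
Proof. by rewrite -[a *: w]addr0 dual_isoPl dual_iso0l addr0. Qed.

Lemma dual_iso_bound : exists b : R, 0 <= b /\
  forall w v, rnorm (J w v) <= b * rnorm w * rnorm v.
Proof.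
have [_ _ [a [b [a0 b0 Jab]]]] := J_iso; exists b; split => [|w v].
  exact: ltW.
apply: le_trans (rnorm_dual_norm v (dual_iso_dual w)) _.
rewrite ler_wpM2r ?rnorm_ge0// -lecR rmorphM/= -rnormE.
by have /andP[] := Jab w.
Qed.

(** This turns a bound on the functional [J w] back into a norm bound on [w], as the boundedness of
    division operators requires. *)
Lemma dual_iso_bounded_below : exists a : R, 0 < a /\
  forall w C, 0 <= C -> (forall v, rnorm (J w v) <= C * rnorm v) ->
    a * rnorm w <= C.
Proof.
have [_ _ [a [b [a0 b0 Jab]]]] := J_iso; exists a; split => // w C C0 JC.
apply: le_trans (dual_norm_le C0 JC).
rewrite -lecR rmorphM/= -rnormE.
by have /andP[] := Jab w.
Qed.

(** The sets on the right form a filter [Phi] along which [J] tends pointwise to [J w]; hence every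
    open set of the initial topology around [w] belongs to [Phi]. *)
Lemma weak_star_nbhsP (w : W) (U : set W) :
  nbhs (w : weak_star J) (U : set (weak_star J)) ->
  exists (vs : seq V) (e : R), 0 < e /\ forall w',
    (forall v, v \in vs -> rnorm (J w v - J w' v) < e) -> U w'.
Proof.
pose Phi : set_system W := fun U => exists (vs : seq V) (e : R), 0 < e /\
  forall w', (forall v, v \in vs -> rnorm (J w v - J w' v) < e) -> U w'.
have PhiF : Filter Phi.
  split; first by exists [::], 1.
    move=> A B [vs [e [e0 A_]]] [vs' [e' [e'0 B_]]].
    exists (vs ++ vs'), (Num.min e e').
    split=> [|w' w'e]; first by rewrite lt_min e0.
    split; [apply: A_ => v vvs|apply: B_ => v vvs].
      by have := w'e v; rewrite mem_cat vvs lt_min => /(_ isT)/andP[].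
    by have := w'e v; rewrite mem_cat vvs orbT lt_min => /(_ isT)/andP[].
  by move=> A B AB [vs [e [e0 A_]]]; exists vs, e; split=> // w' /A_ /AB.
move=> [_ [[B oB <-] Bw] BU].
have JPhi : {ptws, (J : W -> V -> R[i]^o) @ Phi --> (J w : V -> R[i]^o)}.
  apply/pointwise_cvgP => v; apply/cvgrPdist_lt => e e0.
  have eR : 0 < complex.Re e by move: e0; rewrite ltcE => /andP[].
  exists [:: v], (complex.Re e); split=> // w' /(_ v (mem_head _ _)).
  by rewrite /= [`|_|]rnormE -(RRe_real (gtr0_real e0)) ltcR.
have [|vs [e [e0 Bvs]]] := JPhi B; first by apply: open_nbhs_nbhs.
exists vs, e; split=> // w' /Bvs; exact: BU.
Qed.

Lemma weak_star_near (w : W) v (e : R) : 0 < e ->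
  nbhs (w : weak_star J)
    ([set w' : W | rnorm (J w v - J w' v) < e] : set (weak_star J)).
Proof.
move=> e0; have Jc := @initial_continuous _ _ (J : W -> {ptws V -> R[i]^o}) w.
have Jv : (fun w' : weak_star J => J w' v : R[i]^o) @ (w : weak_star J) -->
    (J w v : R[i]^o).
  have /pointwise_cvgP := (Jc : {ptws, (J : weak_star J -> V -> R[i]^o) @
    (w : weak_star J) --> (J w : V -> R[i]^o)}).
  by move=> cJ; apply: (cJ (@fmap_filter _ _ _ (nbhs (w : weak_star J)) _) v).
have eC : 0 < e%:C by rewrite ltcR.
move/cvgrPdist_lt : Jv => /(_ _ eC); apply: filterS => w' /=.
by rewrite [`|_|]rnormE ltcR.
Qed.

(** The pre-annihilator: it is taken in the predual [V], not in the dual of [W]. *)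
Definition perp (A : set W) : set V := [set v | forall w, A w -> J w v = 0].

Lemma weak_star_closure_perp (A : set W) w v :
  weak_star_closure J A w -> perp A v -> J w v = 0.
Proof.
move=> Aw Av; apply: rnorm_eq0; apply/eqP.
rewrite eq_le rnorm_ge0 andbT; apply/ler_addgt0Pr => e e0; rewrite add0r.
have [w' [/Av w'0]] := Aw _ (weak_star_near w v e0).
by rewrite /= w'0 subr0 => /ltW.
Qed.

(** Induction on [n]. The previous interpolant is corrected by an element of [A] vanishing at the
    earlier vectors but not at the new one. If there is none, then on [A] the new evaluation is a
    combination of the others by [ker_span]; the same combination of vectors differs from the new
    one by an element of [perp A], which [w] annihilates too. *)
Lemma perp_interpolation (A : set W) w n (v : 'I_n -> V) :
  lin_subspace A -> (forall u, perp A u -> J w u = 0) ->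
  exists w', A w' /\ forall i, J w' (v i) = J w (v i).
Proof.
move=> sA wA; elim: n v => [|n IH] v.
  by exists 0; split=> [|[]//]; case: sA.
have JA u : linear_on A (J^~ u) by move=> a w1 w2 _ _; exact: dual_isoPl.
have [w' [Aw' w'v]] := IH (fun i => v (lift ord0 i)).
have [[w0 [Aw0 [w0v w0v0]]]|nw] := pselect (exists w0, A w0 /\
    (forall i, J w0 (v (lift ord0 i)) = 0) /\ J w0 (v ord0) <> 0).
  pose a := (J w (v ord0) - J w' (v ord0)) / J w0 (v ord0).
  exists (a *: w0 + w'); split=> [|i]; first exact: sA.2.
  rewrite dual_isoPl; have [j ->|->] := unliftP ord0 i.
    by rewrite w0v mulr0 add0r w'v.
  by rewrite divfK ?subrK//; exact/eqP.
have [c cP] : exists c : 'I_n -> R[i], forall u, A u ->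
    J u (v ord0) = \sum_i c i * J u (v (lift ord0 i)).
  apply: (ker_span (f := fun i => J^~ (v (lift ord0 i)))) => //.
  by move=> u Au uv; apply: contrapT => uv0; apply: nw; exists u.
have JS u : J u (\sum_i c i *: v (lift ord0 i)) =
    \sum_i c i * J u (v (lift ord0 i)).
  apply: (@linear_on_sum _ _ setT) => //.
  by move=> a x y _ _; exact: dual_isoP.
have Jsub u : J u (v ord0 - \sum_i c i *: v (lift ord0 i)) =
    J u (v ord0) - J u (\sum_i c i *: v (lift ord0 i)).
  by rewrite addrC -scaleN1r dual_isoP mulN1r addrC.
exists w'; split=> // i; have [j ->|->] := unliftP ord0 i; first exact: w'v.
have : J w (v ord0 - \sum_i c i *: v (lift ord0 i)) = 0.
  by apply: wA => u Au; rewrite Jsub cP// JS subrr.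
rewrite Jsub JS => /eqP; rewrite subr_eq0 => /eqP ->.
by rewrite cP//; apply: eq_bigr => j _; rewrite w'v.
Qed.

(** A basic weak-star neighbourhood constrains only finitely many values, and these can be
    interpolated by an element of [A]. *)
Lemma bipolar (A : set W) : lin_subspace A ->
  weak_star_closure J A = [set w | forall v, perp A v -> J w v = 0].
Proof.
move=> sA; apply/seteqP; split=> [w Aw v|w wA].
  exact: weak_star_closure_perp.
move=> U /weak_star_nbhsP[vs [e [e0 Uvs]]].
have [w' [Aw' w'v]] := perp_interpolation (tnth (in_tuple vs)) sA wA.
exists w'; split=> //; apply: Uvs => v /(tnthP (in_tuple vs))[i ->].
by rewrite w'v subrr rnorm0.
Qed.

Lemma lin_subspace_perpperp (A : set W) :
  lin_subspace [set w | forall v, perp A v -> J w v = 0].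
Proof.
split=> [v _|a w w' Aw Aw' v Av]; first exact: dual_iso0l.
by rewrite dual_isoPl Aw// Aw'// mulr0 addr0.
Qed.

Lemma lin_subspace_perp (A : set W) : lin_subspace (perp A).
Proof.
split=> [w _|a u v Au Av w Aw]; first exact: dual_iso0.
by rewrite dual_isoP Au// Av// mulr0 addr0.
Qed.

(** [B] is the domain of continuity: the whole space for the shift, the functions vanishing at [l]
    for division. The limit point [w] must lie in [B] as well, hence the separate hypothesis. *)
Lemma weak_star_closure_image (A B C : set W) (T : W -> W) w :
  weak_star_continuous_on J B T -> A `<=` B -> B w ->
  (forall a, A a -> C (T a)) ->
  weak_star_closure J A w -> weak_star_closure J C (T w).
Proof.
move=> cT AB Bw AC Aw U UTw.
have TU : within (B : set (weak_star J)) (nbhs (w : weak_star J)) (T @^-1` U).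
  by rewrite nbhs_subspace_in//; exact: cT.
have [a [Aa /(_ (AB _ Aa)) UTa]] := Aw _ TU.
by exists (T a); split => //; exact: AC.
Qed.

End DualIso.

(** * Shift and division operators *)

Section HolBanach.
Context {R : realType} {Z : hol_banach R}.
Implicit Types (f g : Z) (l z : R[i]).

Lemma unit_discE z : unit_disc z <-> rnorm z < 1.
Proof. by rewrite /unit_disc/= rnormE -[1]/(1%:C) ltcR. Qed.

Lemma evP a f g z : ev (a *: f + g) z = a * ev f z + ev g z.
Proof. by rewrite linearP. Qed.

Lemma evB f g z : ev (f - g) z = ev f z - ev g z.
Proof. by rewrite linearB. Qed.

Lemma evZ a f z : ev (a *: f) z = a * ev f z :> R[i].
Proof. by rewrite linearZ. Qed.

Lemma ev0 z : ev (0 : Z) z = 0 :> R[i].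
Proof. by rewrite linear0. Qed.

Lemma ev_continuous f l (e : R) : unit_disc l -> 0 < e ->
  exists d : R, 0 < d /\
    forall z, rnorm (z - l) < d -> rnorm (ev f z - ev f l) < e.
Proof.
move=> Dl e0.
have cf : {for l, continuous (ev f : R[i]^o -> R[i]^o)}.
  apply: differentiable_continuous; apply/derivable1_diffP.
  exact: (ev_hol f).1.
have eC : 0 < e%:C by rewrite ltcR.
move/cvgrPdist_lt: cf => /(_ _ eC)/nbhs_normP[d /= d0 dP].
exists (complex.Re d); split=> [|z zl].
  by move: d0; rewrite ltcE => /andP[].
have := dP z; rewrite /= -(RRe_real (gtr0_real d0)).
rewrite ![`|_|]rnormE !ltcR -[rnorm (l - z)]rnormN opprB => /(_ zl).
by rewrite -rnormN opprB.
Qed.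

(** Continuity at [l] recovers the one value that an identity divided by [z - l] leaves open. *)
Lemma ev_eq_off l f g : unit_disc l ->
  (forall z, unit_disc z -> z <> l -> ev f z = ev g z) -> f = g.
Proof.
move=> Dl fg; apply: ev_eq => z Dz.
have [zl|] := pselect (z = l); last exact: fg.
rewrite {z}zl in Dz *; apply/eqP; rewrite -subr_eq0 -evB; apply/eqP.
apply: contrapT => /eqP h0.
have rh0 : 0 < rnorm (ev (f - g) l) := rnorm_gt0 h0.
have [d [d0 dP]] := ev_continuous (f - g) Dl rh0.
(* A real offset small enough for the continuity estimate and for [l + t] to stay in the disc. *)
pose t := Num.min (d / 2) ((1 - rnorm l) / 2).
have l1 : 0 < 1 - rnorm l by rewrite subr_gt0; exact/unit_discE.
have t0 : 0 < t by rewrite lt_min !divr_gt0.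
have td : t < d by apply: (@le_lt_trans _ _ (d / 2)); [rewrite ge_min lexx|lra].
have tl : t < 1 - rnorm l.
  apply: (@le_lt_trans _ _ ((1 - rnorm l) / 2)); last by lra.
  by rewrite ge_min lexx orbT.
have := dP (l + t%:C).
rewrite addrAC subrr add0r rnorm_real gtr0_norm// => /(_ td).
rewrite evB fg ?subrr ?add0r; last 2 first.
- apply/unit_discE; apply: le_lt_trans (rnormD _ _) _.
  by rewrite rnorm_real gtr0_norm// -ltrBrDl.
- move/(congr1 (fun x => x - l)).
  rewrite addrAC subrr add0r => /(@complexI R t 0) t00.
  by move: t0; rewrite t00 ltxx.
by rewrite rnormN ltxx.
Qed.

Hypothesis divZ : division_property Z.

Lemma hol_div_unique l f g : unit_disc l ->
  (forall z, unit_disc z -> (z - l) * ev g z = ev f z) -> hol_div l f = g.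
Proof.
move=> Dl gf.
have fl : ev f l = 0 by rewrite -gf// subrr mul0r.
apply: (ev_eq_off Dl) => z Dz zl.
have zl0 : z - l != 0 by rewrite subr_eq0; exact/eqP.
by apply: (mulfI zl0); rewrite gf// hol_divE.
Qed.

Lemma unit_disc0 : unit_disc (0 : R[i]).
Proof. by apply/unit_discE; rewrite rnorm0. Qed.

Lemma hol_shift0 f : ev (hol_shift f) 0 = 0.
Proof. by rewrite hol_shiftE ?mul0r//; exact: unit_disc0. Qed.

Lemma hol_shiftK f : hol_div 0 (hol_shift f) = f.
Proof.
apply: hol_div_unique; first exact: unit_disc0.
by move=> z Dz; rewrite subr0 hol_shiftE.
Qed.

Lemma hol_divK f : ev f 0 = 0 -> hol_shift (hol_div 0 f) = f.
Proof.
move=> f0; apply: ev_eq => z Dz.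
by rewrite hol_shiftE// -(hol_divE divZ unit_disc0 f0 Dz) subr0.
Qed.

Lemma hol_shiftP a f g :
  hol_shift (a *: f + g) = a *: hol_shift f + hol_shift g.
Proof.
apply: ev_eq => z Dz; rewrite evP !hol_shiftE// evP.
by rewrite mulrDr mulrCA.
Qed.

Lemma hol_divZ a l f : unit_disc l -> ev f l = 0 ->
  hol_div l (a *: f) = a *: hol_div l f.
Proof.
move=> Dl fl; apply: hol_div_unique => // z Dz.
by rewrite !evZ mulrCA hol_divE.
Qed.

Lemma hol_div0 l : unit_disc l -> hol_div l (0 : Z) = 0.
Proof.
by move=> Dl; apply: hol_div_unique => // z Dz; rewrite !ev0 mulr0.
Qed.

Lemma ev_bounded l : unit_disc l ->
  exists M : R, forall f, rnorm (ev f l) <= M * rnorm f.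
Proof.
case: divZ => /(_ l) + _ _ Dl => /(_ Dl)[[m m'] MP].
(* The given bound is complex; comparing real parts leaves only its real part [m]. *)
exists m => f.
have := MP f; rewrite [`|ev f l|]rnormE rnormE lecE => /andP[_ /=].
by rewrite mulr0 subr0.
Qed.

Lemma lin_subspace_shift (E : set Z) : lin_subspace E ->
  lin_subspace ((@hol_shift R Z) @` E).
Proof.
move=> sE; split=> [|a _ _ [f Ef <-] [g Eg <-]].
  exists 0; first by case: sE.
  by apply: ev_eq => z Dz; rewrite hol_shiftE// !ev0; exact: mulr0.
by exists (a *: f + g); [exact: sE.2|rewrite hol_shiftP].
Qed.

End HolBanach.

(** * Weak-star closures of invariant subspaces *)

Section BidualEmbedding.
Context {R : realType} {X0 X Y : hol_banach R}.
Context {jY : Y -> X0 -> R[i]} {jX : X -> Y -> R[i]}.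
Hypothesis divX0 : division_property X0.
Hypothesis divX : division_property X.
Hypothesis X0_dual : dual_iso jY.
Hypothesis Y_dual : dual_iso jX.
Hypothesis embedding_inclusion :
  forall f : X0, ev (bidual_embedding jY jX f : X) = ev f :> (R[i] -> R[i]).
Hypothesis shift_cont : weak_star_continuous_on jX setT (@hol_shift R X).
Hypothesis divop_cont : forall l : R[i], unit_disc l ->
  weak_star_continuous_on jX [set f : X | ev f l = 0] (@hol_div R X l).

Local Notation iota := (bidual_embedding jY jX).

(** Evaluation at [f] is a bounded functional on [Y], hence represented in [X], so the choice
    defining [iota f] does not fall back on its default. *)
Lemma bidual_embeddingE f y : jX (iota f) y = jY y f.
Proof.
have [b [b0 bP]] := dual_iso_bound X0_dual.
have fdual : dual_space (fun y => jY y f).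
  apply/dual_spaceP; split=> [a y1 y2|]; first exact: dual_isoPl.
  by exists (b * rnorm f) => y1; rewrite mulrAC.
have [F FP] := dual_iso_surj Y_dual fdual.
apply: (@xgetPex _ 0 [set F : X | forall y, jX F y = jY y f]).
by exists F => y1; rewrite FP.
Qed.

Lemma bidual_embeddingP a f g : iota (a *: f + g) = a *: iota f + iota g.
Proof.
apply: (dual_iso_inj Y_dual) => y.
by rewrite (dual_isoPl Y_dual) !bidual_embeddingE (dual_isoP X0_dual).
Qed.

Lemma bidual_embedding0 : iota 0 = 0.
Proof.
by have := bidual_embeddingP (-1) 0 0; rewrite !scaleN1r !addNr.
Qed.

Lemma bidual_embedding_sum n (c : 'I_n -> R[i]) (e : 'I_n -> X0) :
  iota (\sum_i c i *: e i) = \sum_i c i *: iota (e i).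
Proof.
elim: n c e => [|n IH] c e; first by rewrite !big_ord0 bidual_embedding0.
by rewrite !big_ord_recl bidual_embeddingP IH.
Qed.

Lemma bidual_embeddingB f g : iota (f - g) = iota f - iota g.
Proof.
by rewrite addrC -scaleN1r bidual_embeddingP scaleN1r addrC.
Qed.

Lemma bidual_embedding_shift f : iota (hol_shift f) = hol_shift (iota f).
Proof.
apply: ev_eq => z Dz.
by rewrite hol_shiftE// !embedding_inclusion hol_shiftE.
Qed.

Lemma bidual_embedding_div l f : unit_disc l -> ev f l = 0 ->
  hol_div l (iota f) = iota (hol_div l f).
Proof.
move=> Dl fl; apply: hol_div_unique => // z Dz.
by rewrite !embedding_inclusion hol_divE.
Qed.

Lemma lin_subspace_bidual (E : set X0) : lin_subspace E ->
  lin_subspace [set iota f | f in E].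
Proof.
move=> sE; split=> [|a _ _ [f Ef <-] [g Eg <-]].
  by exists 0; [case: sE|exact: bidual_embedding0].
by exists (a *: f + g); [exact: sE.2|rewrite bidual_embeddingP].
Qed.

(** For each fixed [y], weak-star continuity at 0 bounds the pairing of [hol_div l F] with [y] over
    the [F] in the unit ball that vanish at [l]. Uniform boundedness on [Y] makes this uniform in
    [y], and [dual_iso_bounded_below] gives the norm bound. *)
Lemma hol_div_bounded l : unit_disc l -> exists C : R, 0 <= C /\
  forall F : X, ev F l = 0 -> rnorm (hol_div l F) <= C * rnorm F.
Proof.
move=> Dl.
pose I := {F : X | ev F l = 0 /\ rnorm F <= 1}.
have [b [b0 bP]] := dual_iso_bound Y_dual.
have [||C CP] := @uniform_boundedness R Y I (fun F => jX (hol_div l (sval F))).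
- by move=> F; exact: dual_iso_dual.
- move=> y.
  have nbhs0 : within [set F : weak_star jX | ev (F : X) l = 0]
      (nbhs (0 : weak_star jX))
      (@hol_div R X l @^-1`
        [set G | rnorm (jX (hol_div l (0 : X)) y - jX G y) < 1]).
    rewrite nbhs_subspace_in; last exact: ev0.
    by apply: (divop_cont Dl); exact: weak_star_near.
  have [vs [e [e0 vsP]]] := weak_star_nbhsP nbhs0.
  (* [M] dominates the pairings of the unit ball with every [v] in [vs], so scaling by [e / (M + 1)]
     moves the ball into the weak-star neighbourhood. *)
  pose M := \sum_(v <- vs) b * rnorm v.
  have M0 : 0 <= M by apply: sumr_ge0 => v _; rewrite mulr_ge0 ?rnorm_ge0.
  have M_ge v : v \in vs -> b * rnorm v <= M.
    move=> vvs; rewrite /M (big_rem v)//= lerDl; apply: sumr_ge0 => u _.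
    by rewrite mulr_ge0 ?rnorm_ge0.
  have M1 : 0 < M + 1 by rewrite ltr_wpDl.
  pose t := e / (M + 1); have t0 : 0 < t by rewrite divr_gt0.
  exists t^-1 => -[F [Fl F1]] /=.
  have jX0 := dual_iso0l Y_dual.
  have jXZ := dual_isoZl Y_dual.
  have := vsP (t%:C *: F); rewrite hol_div0// jX0 /=.
  rewrite evZ Fl mulr0 hol_divZ// jXZ sub0r rnormN rnormM rnorm_real.
  rewrite gtr0_norm//.
  move=> tF; rewrite -[leRHS]mul1r ler_pdivlMr// mulrC ltW// tF// => v vvs.
  rewrite jX0 jXZ sub0r rnormN rnormM rnorm_real gtr0_norm//.
  rewrite /t mulrAC ltr_pdivrMr// ltr_pM2l//.
  apply: le_lt_trans (bP F v) _.
  apply: (@le_lt_trans _ _ M); last by rewrite ltrDl.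
  by rewrite (le_trans _ (M_ge _ vvs))// mulrAC ler_piMr// mulr_ge0 ?rnorm_ge0.
have [a [a0 aP]] := dual_iso_bounded_below Y_dual.
exists (`|C| / a); split=> [|F Fl]; first by rewrite divr_ge0// ltW.
have [->|F0] := eqVneq F 0; first by rewrite hol_div0// !rnorm0 mulr0.
have rF0 := rnorm_gt0 F0.
pose s := (rnorm F)^-1; have s0 : 0 < s by rewrite invr_gt0.
have sF : ev (s%:C *: F) l = 0 /\ rnorm (s%:C *: F) <= 1.
  by rewrite evZ Fl mulr0 rnormZ rnorm_real gtr0_norm// mulVf// gt_eqF.
have := aP (hol_div l (s%:C *: F)) `|C| (normr_ge0 _).
rewrite hol_divZ// rnormZ rnorm_real (gtr0_norm s0) mulrCA ler_pdivrMl//.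
rewrite mulrAC ler_pdivlMr// mulrC [leRHS]mulrC; apply => y.
rewrite -hol_divZ//; apply: le_trans (CP (exist _ _ sF) y) _.
by rewrite ler_wpM2r ?rnorm_ge0// ler_norm.
Qed.

(* Dividing repeatedly, [f = (z - l)^n g_n] with [|g_n| <= C^n |f|], where [C] is
   the norm of the division operator at [l]. *)
Lemma vanish_near l : unit_disc l -> (forall f : X0, ev f l = 0) ->
  exists d : R, 0 < d /\ forall z, unit_disc z -> rnorm (z - l) < d ->
    forall f : X0, ev f z = 0.
Proof.
move=> Dl vanish; have [C [C0 CP]] := hol_div_bounded Dl.
have C1 : 0 < C + 1 by rewrite ltr_wpDl.
(* Inside this radius [|z - l| * C < 1], also when [C = 0], so the bounds on [f z] tend to 0. *)
exists (C + 1)^-1; split=> [|z Dz zl f]; first by rewrite invr_gt0.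
have [M MP] := ev_bounded divX Dz.
pose g n : X0 := iter n (@hol_div R X0 l) f.
have gE n : ev f z = (z - l) ^+ n * ev (g n) z.
  elim: n => [|n ->]; first by rewrite mul1r.
  by rewrite exprSr -mulrA hol_divE.
(* The division bound lives in [X], so norms are measured after embedding; each quotient again
   vanishes at [l] by [vanish]. *)
have g_le n : rnorm (iota (g n)) <= C ^+ n * rnorm (iota f).
  elim: n => [|n IH]; first by rewrite mul1r.
  rewrite [g n.+1]iterS -bidual_embedding_div//.
  apply: le_trans (CP _ _) _; first by rewrite embedding_inclusion.
  by rewrite exprS -mulrA ler_wpM2l.
pose q := rnorm (z - l) * C.
have q0 : 0 <= q by rewrite mulr_ge0 ?rnorm_ge0.
have q1 : `|q| < 1.
  rewrite ger0_norm//; move: zl; rewrite -[_^-1]mul1r ltr_pdivlMr//.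
  by apply: le_lt_trans; rewrite ler_wpM2l ?rnorm_ge0// lerDl.
have f_le n : rnorm (ev f z) <= `|M| * rnorm (iota f) * q ^+ n.
  rewrite (gE n) rnormM rnormX -embedding_inclusion.
  rewrite /q exprMn mulrCA ler_wpM2l ?exprn_ge0 ?rnorm_ge0//.
  apply: le_trans (MP _) _; rewrite -mulrA [_ * C ^+ n]mulrC.
  apply: le_trans (ler_wpM2r (rnorm_ge0 _) (ler_norm M)) _.
  by rewrite ler_wpM2l.
apply: rnorm_eq0; apply/eqP; rewrite eq_le rnorm_ge0 andbT.
have q_cvg : `|M| * rnorm (iota f) * q ^+ n @[n --> \oo] --> (0 : R).
  rewrite -[X in _ --> X](mulr0 (`|M| * rnorm (iota f))).
  by apply: cvgM; [exact: cvg_cst|exact: cvg_expr].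
rewrite -(cvg_lim _ q_cvg)//; apply: limr_ge; first exact: cvgP q_cvg.
by apply: nearW => n.
Qed.

(** A connectedness argument along the segment from 0 to [l]: continuity carries common vanishing to
    the supremum [s] of the good parameters, and [vanish_near] carries it past [s] unless
    [s = 1]. *)
Lemma vanish_everywhere : (forall f : X0, ev f 0 = 0) -> forall f : X0, f = 0.
Proof.
move=> vanish0; suff vanish l : unit_disc l -> forall f : X0, ev f l = 0.
  by move=> f; apply: ev_eq => z Dz; rewrite ev0 vanish.
move=> Dl; have /unit_discE l1 := Dl.
have Dt t : 0 <= t -> t <= 1 -> unit_disc (t%:C * l).
  move=> t0 t1; apply/unit_discE; rewrite rnormM rnorm_real ger0_norm//.
  by apply: le_lt_trans l1; rewrite ler_piMl ?rnorm_ge0.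
have rl t s : rnorm (t%:C * l - s%:C * l) <= `|t - s|.
  rewrite -mulrBl -rmorphB rnormM rnorm_real ler_piMr//; exact: ltW.
pose T := [set t : R | 0 <= t <= 1 /\
  forall s, 0 <= s <= t -> forall f : X0, ev f (s%:C * l) = 0].
have T0 : T 0.
  split=> [|s s0 f]; first by rewrite lexx ler01.
  by have -> : s = 0 by [apply/eqP; rewrite eq_le andbC]; rewrite mul0r.
have T1 : ubound T 1 by move=> t [/andP[]].
have supT : has_sup T by split; [exists 0|exists 1].
pose s := sup T.
have s0 : 0 <= s by apply: ub_le_sup => //; exists 1.
have s1 : s <= 1 by apply: ge_sup => //; exists 0.
have below t : 0 <= t -> t < s -> forall f : X0, ev f (t%:C * l) = 0.
  move=> t0 /sup_gt => /(_ (ex_intro _ 0 T0))[u [_ uT] tu].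
  by apply: uT; rewrite t0 ltW.
have at_s (f : X0) : ev f (s%:C * l) = 0.
  apply: rnorm_eq0; apply/eqP; rewrite eq_le rnorm_ge0 andbT.
  have [->|s_neq0] := eqVneq s 0; first by rewrite mul0r vanish0 rnorm0.
  have s_gt0 : 0 < s by rewrite lt_def s_neq0.
  apply/ler_addgt0Pr => e e0; rewrite add0r.
  have [d [d0 dP]] := ev_continuous f (Dt _ s0 s1) e0.
  pose t := Num.max 0 (s - d / 2).
  have t0 : 0 <= t by rewrite le_max lexx.
  have ts : t < s by rewrite gt_max s_gt0/=; lra.
  have td : s - d / 2 <= t by rewrite le_max lexx orbT.
  have := dP (t%:C * l); rewrite (below t)// sub0r rnormN => h.
  apply/ltW/h; apply: le_lt_trans (rl _ _) _.
  by rewrite ltr0_norm; lra.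
have [d [d0 dP]] := vanish_near (Dt _ s0 s1) at_s.
pose t := Num.min 1 (s + d / 2).
have t1 : t <= 1 by rewrite ge_min lexx.
have td : t <= s + d / 2 by rewrite ge_min lexx orbT.
have Tt : T t.
  split=> [|u /andP[u0 ut] f].
    by rewrite t1 le_min ler01 addr_ge0// divr_ge0// ltW.
  have [us|su] := ltP u s; first exact: below.
  apply: dP; first by apply: Dt => //; exact: le_trans t1.
  apply: le_lt_trans (rl _ _) _.
  by rewrite ger0_norm ?subr_ge0//; lra.
have ts : t <= s by apply: ub_le_sup => //; exists 1.
have {}s1 : s = 1.
  apply/eqP; rewrite eq_le s1/=; move: ts; rewrite ge_min => /orP[//|]; lra.
by move=> f; have := at_s f; rewrite s1 mul1r.
Qed.

(* [k] in [Y] represents evaluation at 0 on [X0].  Since [X0] is weak-star dense,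
   [k] also annihilates [zX], so [k] and evaluation at 0 agree on [X]. *)
Lemma weak_star_eval0 (G : X) :
  (forall y, (forall f : X0, ev f 0 = 0 -> jX (iota f) y = 0) -> jX G y = 0) ->
  ev G 0 = 0.
Proof.
move=> Gperp.
have [vanish0|/existsNP[f0 /eqP f00]] := pselect (forall f : X0, ev f 0 = 0).
  suff -> : G = 0 by rewrite ev0.
  apply: (dual_iso_inj Y_dual) => y; rewrite (dual_iso0l Y_dual).
  apply: Gperp => f _.
  rewrite (vanish_everywhere vanish0 f) bidual_embedding0.
  exact: dual_iso0l.
have eval_dual : dual_space (fun f : X0 => ev f 0).
  apply/dual_spaceP; split=> [a f g|]; first exact: evP.
  by have [M MP] := ev_bounded divX0 unit_disc0; exists M.
have [k kP] := dual_iso_surj X0_dual eval_dual.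
have jXk f : jX (iota f) k = ev f 0 by rewrite bidual_embeddingE kP.
(* The annihilator of [range iota] is 0, so by the bipolar theorem every [H] is a weak-star limit of
   elements of [X0]; the shift maps these to functions vanishing at 0, where [k] is 0. *)
have k_shift H : jX (hol_shift H) k = 0.
  apply: (@weak_star_closure_perp _ _ _ _
    [set iota f | f in [set f | ev f 0 = 0]]); last first.
    by move=> _ [f f_0 <-]; rewrite jXk.
  apply: (weak_star_closure_image shift_cont (A := range iota)) => //.
    move=> _ [f _ <-]; exists (hol_shift f); first exact: hol_shift0.
    exact: bidual_embedding_shift.
  rewrite (bipolar Y_dual); last by apply: lin_subspace_bidual.
  move=> v v0 /=; suff -> : v = 0 by exact: dual_iso0.
  apply: (dual_iso_inj X0_dual) => f.
  by rewrite -!bidual_embeddingE (dual_iso0 Y_dual); apply: v0; exists f.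
(* Subtracting this multiple of [f0] yields a function vanishing at 0, hence a shift, which [k]
   annihilates. *)
pose a := ev G 0 / ev f0 0.
have Ga0 : ev (G - a *: iota f0) 0 = 0.
  by rewrite evB evZ embedding_inclusion divfK// subrr.
have := k_shift (hol_div 0 (G - a *: iota f0)).
rewrite hol_divK// addrC -scaleN1r scalerA mulN1r (dual_isoPl Y_dual) jXk.
rewrite (Gperp k); last by move=> f f_0; rewrite jXk.
by rewrite addr0 mulNr divfK// => /eqP; rewrite oppr_eq0 => /eqP.
Qed.

(** * Comparison of [E / zE] with the quotient of the weak-star closure *)

Section InvariantSubspace.
Context {E : set X0}.
Hypothesis sE : lin_subspace E.
Hypothesis E_shift : (@hol_shift R X0) @` E `<=` E.
Hypothesis E_closed : closed E.

Local Notation Ebar := (weak_star_closure jX [set iota f | f in E]).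
Local Notation zE := ((@hol_shift R X0) @` E).
Local Notation zEbar := ((@hol_shift R X) @` Ebar).

Lemma lin_subspace_closure : lin_subspace Ebar.
Proof.
rewrite (bipolar Y_dual); first exact: lin_subspace_perpperp.
exact: lin_subspace_bidual.
Qed.

Lemma bidual_mem_closure f : E f -> Ebar (iota f).
Proof. by move=> Ef; apply: subset_closure; exists f. Qed.

Lemma closure_shift : zEbar `<=` Ebar.
Proof.
move=> _ [F EF <-].
apply: (weak_star_closure_image shift_cont) EF => // _ [f Ef <-].
exists (hol_shift f); first by apply: E_shift; exists f.
exact: bidual_embedding_shift.
Qed.

Lemma closure_sub_shift :
  weak_star_closure jX [set iota f | f in zE] `<=` zEbar.
Proof.
move=> G zEG; have G0 : ev G 0 = 0.
  apply: weak_star_eval0 => y yP; apply: (weak_star_closure_perp zEG).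
  by move=> _ [_ [f Ef <-] <-]; apply: yP; exact: hol_shift0.
exists (hol_div 0 G); last exact: hol_divK.
apply: (weak_star_closure_image (divop_cont unit_disc0)) zEG => //.
  by move=> _ [_ [f Ef <-] <-] /=; rewrite embedding_inclusion hol_shift0.
move=> _ [_ [f Ef <-] <-]; exists f => //.
by rewrite bidual_embedding_shift hol_shiftK.
Qed.

(** A functional separating [f] from the norm-closed [E] is represented by some [y] in [Y];
    annihilating [E], it annihilates the weak-star closure. *)
Lemma bidual_closure_mem f : Ebar (iota f) -> E f.
Proof.
move=> Ef; apply: contrapT => nEf.
have [phi [phi_dual phiE]] := hahn_banach_separation sE E_closed nEf.
have [y yP] := dual_iso_surj X0_dual phi_dual.
rewrite -yP -bidual_embeddingE; apply; apply: (weak_star_closure_perp Ef).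
by move=> _ [g Eg <-]; rewrite bidual_embeddingE yP phiE.
Qed.

(** Division by [z] commutes with the embedding, so the preimage [F] is the image of [f / z], which
    then lies in [E]. *)
Lemma bidual_shift_mem f : zEbar (iota f) -> zE f.
Proof.
move=> [F EF Ff]; have f0 : ev f 0 = 0.
  by rewrite -embedding_inclusion -Ff hol_shift0.
exists (hol_div 0 f); last exact: hol_divK.
apply: bidual_closure_mem.
rewrite -bidual_embedding_div//; last exact: unit_disc0.
by rewrite -Ff hol_shiftK.
Qed.

Lemma mem_shift_closure f : zE f -> zEbar (iota f).
Proof.
move=> [g Eg <-]; exists (iota g); first exact: bidual_mem_closure.
by rewrite bidual_embedding_shift.
Qed.

Let szE : lin_subspace zE. Proof. exact: lin_subspace_shift. Qed.
Let sEbar := lin_subspace_closure.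
Let szEbar : lin_subspace zEbar. Proof. exact: lin_subspace_shift. Qed.

(* On the annihilator of [zE], an element of [Ebar] depends only on the finitely
   many values [<e_i, y>], so it is a combination of the [e_i] modulo the
   weak-star closure of [zE]. *)
Lemma quotient_basis_closure n (e : 'I_n -> X0) :
  quotient_basis E zE e -> quotient_basis Ebar zEbar (fun i => iota (e i)).
Proof.
move=> /(quotient_basisP _ sE szE)[Ee spane freee].
apply/(quotient_basisP _ sEbar szEbar); split => [i|F EF|c].
- exact/bidual_mem_closure/Ee.
- pose P := perp (J := jX) [set iota f | f in zE].
  have sP : lin_subspace P by exact: lin_subspace_perp.
  have lP (G : X) : linear_on P (jX G) by move=> a u v _ _; exact: dual_isoP.
  have [c cP] : exists c : 'I_n -> R[i], forall y, P y ->
      jX F y = \sum_i c i * jX (iota (e i)) y.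
    apply: ker_span => // y Py ye; apply: (weak_star_closure_perp EF).
    move=> _ [f Ef <-]; have [c zEc] := spane f Ef.
    have : jX (iota (f - \sum_i c i *: e i)) y = 0.
      by apply: Py; exists (f - \sum_i c i *: e i).
    rewrite bidual_embeddingB bidual_embedding_sum => fy.
    have lJ : linear_on setT (jX^~ y) by move=> a u v _ _; exact: dual_isoPl.
    have sT : lin_subspace [set: X] by [].
    rewrite -[iota f](subrK (\sum_i c i *: iota (e i))) -[_ - _]scale1r lJ//.
    rewrite fy mulr0 add0r (linear_on_sum _ sT lJ)//.
    by rewrite big1// => i _; rewrite ye mulr0.
  (* The difference is annihilated by all of [P], so the bipolar theorem puts it in the weak-star
     closure of [zE]. *)
  exists c; apply: closure_sub_shift; rewrite (bipolar Y_dual); last first.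
    exact: lin_subspace_bidual.
  move=> y Py /=.
  have lJ : linear_on setT (jX^~ y) by move=> a u v _ _; exact: dual_isoPl.
  have sT : lin_subspace [set: X] by [].
  by rewrite (linear_onB lJ)// (linear_on_sum _ sT lJ)// cP// subrr.
- by rewrite -bidual_embedding_sum => /bidual_shift_mem/freee.
Qed.

(** The coordinates of [iota f] in the given basis are [n] linear functionals of [f] on [E], and
    their common kernel is [zE]; thus [E / zE] has finite dimension. *)
Lemma quotient_basis_restrict n (F : 'I_n -> X) :
  quotient_basis Ebar zEbar F ->
  exists m (e : 'I_m -> X0), quotient_basis E zE e.
Proof.
move=> /(quotient_basisP _ sEbar szEbar)[EF spanF freeF].
have /choice[c cP] (f : X0) : exists c : 'I_n -> R[i],
    E f -> zEbar (iota f - \sum_i c i *: F i).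
  (* Outside [E] the coordinates are set to 0 by default; they are used on [E] only. *)
  have [Ef|nEf] := pselect (E f); last by exists (fun=> 0).
  by have [c zEc] := spanF _ (bidual_mem_closure Ef); exists c.
have [|i a f g Ef Eg|f Ef||m [e eP]] :=
    @finite_quotient_basis _ X0 n (fun i f => c f i) E zE.
- exact: sE.
- apply/eqP; rewrite -subr_eq0; apply/eqP.
  (* The defect of linearity of the coordinates gives a combination of the [F i] in [zEbar], so
     independence makes it zero. *)
  apply: (freeF (fun i => c (a *: f + g) i - (a * c f i + c g i))).
  have cfg : zEbar (a *: (iota f - \sum_i c f i *: F i) +
      (iota g - \sum_i c g i *: F i)) by apply: szEbar.2; exact: cP.
  have := lin_subspaceB szEbar cfg (cP _ (sE.2 a f g Ef Eg)).
  congr (zEbar _); rewrite bidual_embeddingP.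
  under [RHS]eq_bigr do rewrite scalerBl scalerDl -scalerA.
  rewrite sumrB big_split/= -scaler_sumr scalerBr.
  by rewrite addrACA -opprD opprB [LHS]addrC addrA subrK.
- split=> [zEf i|cf0].
    apply: (freeF (c f)).
    have := lin_subspaceB szEbar (mem_shift_closure zEf) (cP f Ef).
    by rewrite opprB addrC subrK.
  apply: bidual_shift_mem; have := cP f Ef.
  by rewrite big1 ?subr0// => i _; rewrite cf0 scale0r.
- exact: E_shift.
- by exists m, e; apply/(quotient_basisP _ sE szE).
Qed.

End InvariantSubspace.
End BidualEmbedding.

Unset Implicit Arguments.
Set Strict Implicit.

Theorem theorem1p6 (R : realType) (X0 X Y : hol_banach R)
  (divX0 : division_property X0)
  (divX : division_property X)
  (divY : division_property Y)
  (jY : Y -> X0 -> R[i]) (jX : X -> Y -> R[i])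
  (X0_dual : dual_iso jY)
  (Y_dual : dual_iso jX)
  (embedding_inclusion :
     forall f : X0, ev (bidual_embedding jY jX f : X) = ev f :> (R[i] -> R[i]))
  (shift_cont : weak_star_continuous_on jX setT (@hol_shift R X))
  (divop_cont : forall l : R[i], unit_disc l ->
     weak_star_continuous_on jX [set f : X | ev f l = 0] (@hol_div R X l))
  (E : set X0)
  (E_closed : closed E)
  (E_inv : invariant_subspace E)
  (N : option nat) (N_pos : N <> Some 0%N)
  (E_index : shift_index E N) :
  let Ebar : set X :=
    weak_star_closure jX [set bidual_embedding jY jX f | f in E] in
  [/\ invariant_subspace Ebar,
      weak_star_closed jX Ebar
    & shift_index Ebar N].
Proof.
have sE : lin_subspace E by apply/submod_closedE; case: E_inv.
have zE : (@hol_shift R X0) @` E `<=` E by case: E_inv.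
split.
- split; first by apply/submod_closedE; exact: lin_subspace_closure.
  exact: closure_shift.
- exact: closed_closure.
case: N N_pos E_index => [n _ [e eP]|_ E_inf n F FP].
  exists (fun i => bidual_embedding jY jX (e i)).
  exact: quotient_basis_closure.
(* In the infinite case, a finite basis upstairs would yield one of [E / zE]. *)
have [m [e eP]] := quotient_basis_restrict divX0 divX X0_dual Y_dual
  embedding_inclusion sE zE E_closed FP.
exact: E_inf eP.
Qed.
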